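(* Suppose that the full system $\dot z=f(z,u)$ with $z=(z_1,z_2,z_c)$ can be decomposed into the form $\dot z_1=f_1(z_1,z_c,u_1)$, $\dot z_2=f_2(z_2,z_c,u_2)$, $\dot z_c=f_c(z_c)$, where the subsystem controls do not have any shared components, so that $u=(u_1,u_2)$. Let $t<0$. If the target sets satisfy $\mathcal T=\mathrm{proj}_1^{-1}(\mathcal T_1)\cap \mathrm{proj}_2^{-1}(\mathcal T_2)$, then the maximal backward reachable sets satisfy $$\mathcal R(t)=\mathrm{proj}_1^{-1}(\mathcal R_1(t))\cap \mathrm{proj}_2^{-1}(\mathcal R_2(t)).$$
   Context: System: $z\in\mathbb R^n$ evolves by $\dot z(s)=f(z(s),u(s))$, $s\in[t,0]$, $t<0$, with $u(s)\in\mathcal U$, $\mathcal U\subset\mathbb R^{n_u}$ compact; $f:\mathbb R^n\times\mathcal U\to\mathbb R^n$ is uniformly continuous, bounded, and Lipschitz continuous in $z$ for fixed $u$. Control functions $u(\cdot)$ range over the set $\mathbb U$ of measurable functions with values in $\mathcal U$. For each $z$ and $u(\cdot)$ let $\zeta(s;z,t,u(\cdot))$, $s\in[t,0]$, be the unique trajectory (satisfying the ODE for almost every $s$) with $\zeta(t;z,t,u(\cdot))=z$. State partition: $z=(z_1,z_2,z_c)$ with $z_i\in\mathbb R^{n_i}$, $z_c\in\mathbb R^{n_c}$, $n_1,n_2>0$, $n_c\ge 0$, $n_1+n_2+n_c=n$. Subsystem states are $x_i=(z_i,z_c)\in\mathbb R^{n_i+n_c}$, $i=1,2$. The control is $u=(u_1,u_2)$,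 where $u_i$ is the control of subsystem $i$. Subsystem $i$ has dynamics $\dot z_i=f_i(z_i,z_c,u_i)$, $\dot z_c=f_c(z_c)$. Its trajectory starting at $x_i$ at time $t$ under $u(\cdot)=(u_1(\cdot),u_2(\cdot))\in\mathbb U$ depends on $u(\cdot)$ only through $u_i(\cdot)$ and is denoted $\xi_i(s;x_i,t,u_i(\cdot))$. Back-projection: for $S_i\subseteq\mathbb R^{n_i+n_c}$, $\mathrm{proj}_i^{-1}(S_i)=\{z=(z_1,z_2,z_c)\in\mathbb R^n:(z_i,z_c)\in S_i\}$. Target sets: $\mathcal T\subseteq\mathbb R^n$ (full system), $\mathcal T_i\subseteq\mathbb R^{n_i+n_c}$ (subsystem $i$). Maximal backward reachable sets: $\mathcal R(t)=\{z:\exists u(\cdot)\in\mathbb U,\ \zeta(0;z,t,u(\cdot))\in\mathcal T\}$ and $\mathcal R_i(t)=\{x_i:\exists u(\cdot)=(u_1(\cdot),u_2(\cdot))\in\mathbb U,\ \xi_i(0;x_i,t,u_i(\cdot))\in\mathcal T_i\}$, $i=1,2$.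
   Formalization: The control set is assumed to be a product U = U_1 × U_2, so that u_1 and u_2 can be chosen independently; for a general compact U (e.g. the diagonal u_1 = u_2) the claim as written is false. *)

(* Defs.v *)
From HB Require Import structures.
From mathcomp Require Import all_boot all_order all_algebra.
From mathcomp Require Import all_classical all_reals all_analysis.
From mathcomp Require Import measurable_realfun.

Set Implicit Arguments.
Unset Strict Implicit.
Unset Printing Implicit Defensive.

Import Order.TTheory GRing.Theory Num.Theory.
Import numFieldNormedType.Exports.

Local Open Scope classical_set_scope.
Local Open Scope ring_scope.

(* Lebesgue measurability: R carries the completion of its Borel sigma-algebra
   for the Lebesgue measure, and R^k its Borel sigma-algebra. *)
Definition lebesgue_measurable_fun (R : realType) (k : nat) (D : set R)
    (g : R -> 'rV[R]_k) : Prop :=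
  measurable_fun
    (D : set (g_sigma_algebraType (completed_algebra_gen (@lebesgue_measure R))))
    (g : _ -> g_sigma_algebraType (@open 'rV[R]_k)).

(* Only the restriction of u to [t, 0] is relevant. *)
Definition controls (R : realType) (m : nat) (U : set 'rV[R]_m) (t : R) :
    set (R -> 'rV[R]_m) :=
  [set u | lebesgue_measurable_fun `[t, 0] u /\
           forall s, s \in `[t, 0] -> U (u s)].

Definition abs_continuous (R : realType) (k : nat) (a b : R)
    (g : R -> 'rV[R]_k) : Prop :=
  forall e : R, 0 < e -> exists2 d : R, 0 < d &
    forall J : seq (R * R),
      all (fun i => [&& a <= i.1, i.1 <= i.2 & i.2 <= b]) J ->
      pairwise (fun i j => (i.2 <= j.1) || (j.2 <= i.1)) J ->
      \sum_(i <- J) (i.2 - i.1) < d ->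
      \sum_(i <- J) `|g i.2 - g i.1| < e.

(* Solutions are meant in the sense of Caratheodory. Without absolute
   continuity, an equation that holds almost everywhere does not determine the
   trajectory: a Cantor function can be added to any solution of dx/ds = v(s). *)
Definition is_trajectory (R : realType) (k m : nat)
    (F : 'rV[R]_k -> 'rV[R]_m -> 'rV[R]_k) (t : R) (x : 'rV[R]_k)
    (u : R -> 'rV[R]_m) (xi : R -> 'rV[R]_k) : Prop :=
  [/\ xi t = x,
      abs_continuous t 0 xi &
      {ae @lebesgue_measure R, forall s, s \in `[t, 0] ->
        is_derive (s : R^o) 1 (xi : R^o -> 'rV[R]_k) (F (xi s) (u s))}].

Definition is_unique_trajectory (R : realType) (k m : nat)
    (F : 'rV[R]_k -> 'rV[R]_m -> 'rV[R]_k) (t : R) (x : 'rV[R]_k)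
    (u : R -> 'rV[R]_m) (xi : R -> 'rV[R]_k) : Prop :=
  is_trajectory F t x u xi /\
  forall xi' : R -> 'rV[R]_k, is_trajectory F t x u xi' ->
    {in `[t, 0], xi' =1 xi}.

(* "The trajectory from x under u(.) satisfies xi(0) \in T" is rendered by
   quantifying over the function xi that is the unique trajectory; the values
   of xi outside [t, 0] play no role. *)
Definition max_brs (R : realType) (k m : nat)
    (F : 'rV[R]_k -> 'rV[R]_m -> 'rV[R]_k) (U : set 'rV[R]_m)
    (T : set 'rV[R]_k) (t : R) : set 'rV[R]_k :=
  [set x | exists2 u, controls U t u &
     exists2 xi, is_unique_trajectory F t x u xi & T (xi 0)].

(* The control ranges over the controls of the full system; the subsystem is
   driven by its component [part u]. *)
Definition sub_max_brs (R : realType) (k m mi : nat)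
    (F : 'rV[R]_k -> 'rV[R]_mi -> 'rV[R]_k) (part : 'rV[R]_m -> 'rV[R]_mi)
    (U : set 'rV[R]_m) (T : set 'rV[R]_k) (t : R) : set 'rV[R]_k :=
  [set x | exists2 u, controls U t u &
     exists2 xi, is_unique_trajectory F t x (part \o u) xi & T (xi 0)].

(* A full state (z1, z2, zc) is [row_mx (row_mx z1 z2) zc]. *)
Definition st1 (R : realType) (n1 n2 nc : nat) (z : 'rV[R]_(n1 + n2 + nc)) :
  'rV[R]_n1 := lsubmx (lsubmx z).
Definition st2 (R : realType) (n1 n2 nc : nat) (z : 'rV[R]_(n1 + n2 + nc)) :
  'rV[R]_n2 := rsubmx (lsubmx z).
Definition stc (R : realType) (n1 n2 nc : nat) (z : 'rV[R]_(n1 + n2 + nc)) :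
  'rV[R]_nc := rsubmx z.

Definition proj1 (R : realType) (n1 n2 nc : nat)
    (z : 'rV[R]_(n1 + n2 + nc)) : 'rV[R]_(n1 + nc) :=
  row_mx (st1 z) (stc z).
Definition proj2 (R : realType) (n1 n2 nc : nat)
    (z : 'rV[R]_(n1 + n2 + nc)) : 'rV[R]_(n2 + nc) :=
  row_mx (st2 z) (stc z).

Definition sub_dynamics (R : realType) (ni nc mi : nat)
    (fi : 'rV[R]_ni -> 'rV[R]_nc -> 'rV[R]_mi -> 'rV[R]_ni)
    (fc : 'rV[R]_nc -> 'rV[R]_nc)
    (x : 'rV[R]_(ni + nc)) (ui : 'rV[R]_mi) : 'rV[R]_(ni + nc) :=
  row_mx (fi (lsubmx x) (rsubmx x) ui) (fc (rsubmx x)).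

Definition decomposes (R : realType) (n1 n2 nc m1 m2 : nat)
    (f : 'rV[R]_(n1 + n2 + nc) -> 'rV[R]_(m1 + m2) -> 'rV[R]_(n1 + n2 + nc))
    (U : set 'rV[R]_(m1 + m2))
    (f1 : 'rV[R]_n1 -> 'rV[R]_nc -> 'rV[R]_m1 -> 'rV[R]_n1)
    (f2 : 'rV[R]_n2 -> 'rV[R]_nc -> 'rV[R]_m2 -> 'rV[R]_n2)
    (fc : 'rV[R]_nc -> 'rV[R]_nc) : Prop :=
  forall z u, U u ->
    f z u = row_mx (row_mx (f1 (st1 z) (stc z) (lsubmx u))
                           (f2 (st2 z) (stc z) (rsubmx u)))
                   (fc (stc z)).

(* U = U1 x U2: the components u1 and u2 of the control are chosen
   independently of each other. *)
Definition control_product (R : realType) (m1 m2 : nat)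
    (U1 : set 'rV[R]_m1) (U2 : set 'rV[R]_m2) : set 'rV[R]_(m1 + m2) :=
  [set u | U1 (lsubmx u) /\ U2 (rsubmx u)].

(* The subspace uniformity restricts uniform continuity to R^k x U. The
   Lipschitz constant may depend on u. *)
Definition regular_dynamics (R : realType) (k m : nat)
    (f : 'rV[R]_k -> 'rV[R]_m -> 'rV[R]_k) (U : set 'rV[R]_m) : Prop :=
  [/\ unif_continuous
        ((fun p => f p.1 p.2) : subspace ([set: 'rV[R]_k] `*` U) -> 'rV[R]_k),
      [bounded f p.1 p.2 | p in [set: 'rV[R]_k] `*` U] &
      forall u, U u -> [lipschitz f z u | z in [set: 'rV[R]_k]]].

(* Main.v *)
Require Import Defs.
From mathcomp Require Import all_boot all_order all_algebra.
From mathcomp Require Import all_classical all_reals all_analysis.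
From mathcomp Require Import measurable_realfun.
From mathcomp Require Import lra.
Import Order.TTheory GRing.Theory Num.Theory.
Import numFieldNormedType.Exports.
Local Open Scope classical_set_scope.
Local Open Scope ring_scope.

(** A trajectory of the full system is the same thing as a pair of subsystem
    trajectories with the same common part: [proj1] and [proj2] split it, [glue]
    puts it back together, and both operations only select coordinates, so they
    preserve absolute continuity and act on derivatives coordinate by
    coordinate ([is_trajectory_coordinate_map]).  Since the controls of the two
    subsystems range over a product, a control that is good for subsystem 1 and
    one that is good for subsystem 2 are combined into a control of the full
    system that is good for both ([controls_row_mx]); its measurability is that
    of its coordinates, because an open set of row vectors is a countable union
    of rational boxes ([measurable_fun_rowP]).

    Gluing needs the common parts of the two trajectories to coincide.  They
    solve the same autonomous equation dz_c/ds = f_c(z_c) from the same point,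
    and f_c inherits a Lipschitz constant from f ([common_dynamics_lipschitz]),
    so this is a uniqueness theorem for Caratheodory solutions
    ([lipschitz_trajectory_unique]).  The uniqueness of trajectories that is part
    of reachability is transported through the same correspondence: a competitor
    of a subsystem trajectory, glued to the other subsystem trajectory, is a
    competitor of the full one, and projecting does the converse
    ([is_unique_trajectory_proj], [is_unique_trajectory_glue]).

    The uniqueness theorem rests on a mean value inequality: an absolutely
    continuous function whose derivative is almost everywhere at most c in norm
    increases by at most c (b - a) over [a, b] ([abs_continuous_increment_le]).
    It is proved without integration or covering theorems.  Points of
    differentiability have small intervals around them on which the increment is
    at most (c + e) times the length; the exceptional points have small
    intervals contained in an open set of measure so small that absolute
    continuity bounds all the increments over them together by e.
    [interval_induction] chains such intervals from a to b. *)

Set Implicit Arguments.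
Unset Strict Implicit.
Unset Printing Implicit Defensive.

(** * A mean value inequality for absolutely continuous functions *)

(** Cousin's lemma for a transitive relation between endpoints: if every point
    has a neighbourhood on which [P] relates the two sides of the point, then
    these intervals can be chained.  The supremum of the points reached from [a]
    is itself reached, and cannot lie below [b]. *)
Lemma interval_induction (R : realType) (a b : R) (P : R -> R -> Prop) :
    a <= b ->
    (forall x y z, x <= y -> y <= z -> P x y -> P y z -> P x z) ->
    (forall x, a <= x <= b -> exists2 d, 0 < d &
      forall y z, a <= y -> y <= x -> x <= z -> z <= b ->
        x - d < y -> z < x + d -> P y z) ->
  P a b.
Proof.
move=> ab Ptrans Ploc.
have [d0 d0_gt0 Pd0] : exists2 d, 0 < d &
    forall y z, a <= y -> y <= a -> a <= z -> z <= b ->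
      a - d < y -> z < a + d -> P y z by apply: Ploc; rewrite lexx.
pose S := [set s | a <= s <= b /\ P a s].
have Sa : S a by split; [rewrite lexx | apply: Pd0 => //; lra].
have Sb : has_ubound S by exists b => s [/andP[]].
have hsS : has_sup S by split; first by exists a.
set c := sup S.
have ac : a <= c by apply: ub_le_sup.
have cb : c <= b by apply: ge_sup; [exists a | move=> s [/andP[]]].
have [d d_gt0 Pd] := Ploc c (introT andP (conj ac cb)).
have [s Ss sc] := sup_adherent d_gt0 hsS.
have [/andP[as_ sb] Pas] := Ss.
have lesc : s <= c by apply: ub_le_sup.
pose y := Order.min b (c + d / 2).
have yb : y <= b by rewrite /y; case: (leP b (c + d / 2)) => ?; lra.
have cy : c <= y by rewrite /y; case: (leP b (c + d / 2)) => ?; lra.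
have yd : y < c + d by rewrite /y; case: (leP b (c + d / 2)) => ?; lra.
have Pay : P a y by apply: (Ptrans a s y) => //; [lra | apply: Pd => //].
have yc : y <= c by apply: ub_le_sup => //; split=> //; lra.
have -> : b = y by move: yc; rewrite /y; case: (leP b (c + d / 2)) => ? ?; lra.
by [].
Qed.

Lemma is_derive_increment_le (R : realType) (k : nat) (g : R -> 'rV[R]_k)
    (x c e : R) (v : 'rV[R]_k) :
    is_derive (x : R^o) 1 (g : R^o -> 'rV[R]_k) v -> `|v| <= c -> 0 < e ->
  exists2 d, 0 < d &
    forall y, `|y - x| < d -> `|g y - g x| <= (c + e) * `|y - x|.
Proof.
move=> [dg dv] vc e0.
have : (h^-1 *: (g (h + x) - g x)) @[h --> 0^'] --> v.
  have /= := dg; rewrite -dv /derive => /cvg_ex[l gl].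
  have -> := cvg_lim (@norm_hausdorff _ _) gl.
  apply: cvg_trans gl; apply: near_eq_cvg; near=> h.
  by rewrite /= [h *: _]mulr1.
move/cvgrPdist_le => /(_ e e0) [d /= d0 H].
exists d => // y yd.
have [->|yx] := eqVneq y x; first by rewrite !subrr !normr0 mulr0.
have yx0 : y - x != 0 by rewrite subr_eq0.
have := H (y - x); rewrite /ball_ /= sub0r normrN => /(_ yd yx0).
rewrite subrK => Hv.
have : `|(y - x)^-1 *: (g y - g x)| <= c + e.
  rewrite -[X in `|X|](subKr v) (le_trans (ler_normB _ _))// lerD//.
rewrite normrZ normfV mulrC ler_pdivrMr// normr_gt0//.
Unshelve. all: by end_near.
Qed.

Lemma negligible_open_cover (R : realType) (N : set R) (e : R) :
    (@lebesgue_measure R).-negligible N -> 0 < e ->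
  exists O : set R, [/\ open O, N `<=` O & (lebesgue_measure O < e%:E)%E].
Proof.
move=> [A [mA A0 NA]] e0.
have [|O [oO AO Oe]] := lebesgue_regularity_outer mA _ e0; first by rewrite [X in (X < _)%E]A0.
exists O; split => //; first exact: subset_trans AO.
have mO : measurable O by exact: open_measurable.
rewrite -(setDUK AO) measureU//; first by rewrite [X in (X + _)%E]A0 add0e.
  exact: measurableD.
by rewrite setDIK.
Qed.

Lemma measure_itv_split (R : realType) (O : set R) (x y z : R) :
    measurable O -> x <= y -> y <= z ->
  (lebesgue_measure (O `&` `[x, y[) + lebesgue_measure (O `&` `[y, z[) =
   lebesgue_measure (O `&` `[x, z[))%E.
Proof.
move=> mO xy yz; rewrite -measureU; first last.
- rewrite setIACA setIid -subset0 => s [_ []] /=.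
  by rewrite !in_itv/= => /andP[_ sy] /andP[ys _]; move: (lt_le_trans sy ys); rewrite ltxx.
- by apply: measurableI.
- by apply: measurableI.
rewrite -setIUr; congr (lebesgue_measure (_ `&` _)).
apply/seteqP; split=> s /=; rewrite !in_itv/=.
  by case=> /andP[? ?]; apply/andP; split; lra.
by move=> /andP[? ?]; case: (ltP s y) => ?; [left|right]; apply/andP; split; lra.
Qed.

(** [P y z] below bounds the increment of [g] from [y] to [z] by a linear term
    and by the increments over a list [J] of intervals on which nothing is known
    about the derivative.  Bounding the total length of [J] by the measure of
    the part of [V] in [[y, z[] makes [P] additive over adjacent intervals. *)
Lemma abs_continuous_increment_le (R : realType) (k : nat) (g : R -> 'rV[R]_k)
    (a b c : R) :
    a <= b -> 0 <= c -> abs_continuous a b g ->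
    {ae @lebesgue_measure R, forall s, s \in `[a, b] ->
      exists2 v, is_derive (s : R^o) 1 (g : R^o -> 'rV[R]_k) v & `|v| <= c} ->
  `|g b - g a| <= c * (b - a).
Proof.
move=> ab c0 gac gae.
apply/ler_addgt0Pr => e0 e0_gt0.
(* [e] is spent once on the exceptional part and [b - a] times on the slope. *)
pose e := e0 / (b - a + 1).
have e_gt0 : 0 < e by rewrite divr_gt0//; lra.
have [d d0 Hd] := gac e e_gt0.
have [V [oV NV Vd]] := negligible_open_cover gae d0.
have mV : measurable V by exact: open_measurable.
pose P y z := exists J : seq (R * R),
  [/\ all (fun i => [&& y <= i.1, i.1 <= i.2 & i.2 <= z]) J,
      pairwise (fun i j => (i.2 <= j.1) || (j.2 <= i.1)) J,
      ((\sum_(i <- J) (i.2 - i.1))%:E <= lebesgue_measure (V `&` `[y, z[))%E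
    & `|g z - g y| <= (c + e) * (z - y) + \sum_(i <- J) `|g i.2 - g i.1|].
have [J [Jab Jdisj JV Jg]] : P a b.
  apply: interval_induction => //.
    move=> x y z xy yz [J [J1 J2 J3 J4]] [K [K1 K2 K3 K4]].
    exists (J ++ K); split.
    - rewrite all_cat; apply/andP; split.
        by apply: sub_all J1 => i /and3P[? ? ?]; apply/and3P; split=> //; lra.
      by apply: sub_all K1 => i /and3P[? ? ?]; apply/and3P; split=> //; lra.
    - rewrite pairwise_cat J2 K2 !andbT; apply/allrelP => i j iJ jK.
      move/allP: J1 => /(_ _ iJ)/and3P[? ? ?].
      move/allP: K1 => /(_ _ jK)/and3P[? ? ?].
      by apply/orP; left; lra.
    - by rewrite big_cat/= EFinD -(measure_itv_split mV xy yz) leeD.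
    - rewrite big_cat/= -(subrKA (g y)).
      by apply: le_trans (ler_normD _ _) _; lra.
  move=> x /andP[ax xb].
  have [Vx|Vx] := pselect (V x).
    have /nbhs_ballP[r /= r0 xr] := open_nbhs_nbhs (conj oV Vx).
    exists r => // y z ay yx xz zb xry zxr; exists [:: (y, z)]; split=> //=.
    - by rewrite !lexx (le_trans yx xz).
    - rewrite big_seq1/= (_ : V `&` _ = `[y, z[%classic).
        rewrite lebesgue_measure_itv/= lte_fin; case: (ltP y z) => // zy.
        by rewrite lee_fin; lra.
      apply/seteqP; split => s; first by case.
      move=> sI; split => //; apply: xr; rewrite /ball/=.
      move: sI; rewrite /= in_itv/= => /andP[ys sz].
      by rewrite ltr_norml; apply/andP; split; lra.
    - by rewrite big_seq1/= lerDr mulr_ge0//; lra.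
  have [v gv vc] : exists2 v,
      is_derive (x : R^o) 1 (g : R^o -> 'rV[R]_k) v & `|v| <= c.
    apply: contrapT => H; apply: Vx; apply: NV => /= /(_ _)/H; apply.
    by rewrite in_itv/= ax.
  have [r r0 Hr] := is_derive_increment_le gv vc e_gt0.
  exists r => // y z ay yx xz zb xry zxr; exists [::]; split=> //=.
    by rewrite big_nil.
  rewrite big_nil addr0 -(subrKA (g x)) (le_trans (ler_normD _ _))//.
  have xy_lt : `|y - x| < r by rewrite ler0_norm; lra.
  have zx_lt : `|z - x| < r by rewrite ger0_norm; lra.
  have := Hr z zx_lt; have := Hr y xy_lt; rewrite [`|g y - _|]distrC.
  by rewrite ler0_norm ?ger0_norm; lra.
have Jd : \sum_(i <- J) (i.2 - i.1) < d.
  rewrite -lte_fin (le_lt_trans JV)// (le_lt_trans _ Vd)// le_measure ?inE//.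
  exact: measurableI.
apply: le_trans Jg _.
have := Hd J Jab Jdisj Jd.
have : e * (b - a + 1) = e0 by rewrite /e divfK//; lra.
nra.
Qed.

(** * Uniqueness of Caratheodory solutions *)

Lemma abs_continuous_le2 (R : realType) (k k1 k2 : nat) (a b : R)
    (h : R -> 'rV[R]_k) (g1 : R -> 'rV[R]_k1) (g2 : R -> 'rV[R]_k2) :
    (forall x y, `|h y - h x| <= `|g1 y - g1 x| + `|g2 y - g2 x|) ->
    abs_continuous a b g1 -> abs_continuous a b g2 ->
  abs_continuous a b h.
Proof.
move=> hg ac1 ac2 e e0.
have e20 : 0 < e / 2 by rewrite divr_gt0.
have [d1 d10 H1] := ac1 _ e20; have [d2 d20 H2] := ac2 _ e20.
exists (Order.min d1 d2); first by rewrite lt_min d10.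
move=> J Jab Jdisj; rewrite lt_min => /andP[Jd1 Jd2].
rewrite (le_lt_trans (ler_sum _ (fun i _ => hg i.1 i.2)))//.
by rewrite big_split/= [e]splitr ltrD ?H1 ?H2.
Qed.

Lemma abs_continuous_sub (R : realType) (k : nat) (a b p q : R)
    (g : R -> 'rV[R]_k) :
  a <= p -> q <= b -> abs_continuous a b g -> abs_continuous p q g.
Proof.
move=> ap qb gac e e0; have [d d0 H] := gac e e0.
exists d => // J Jpq; apply: H; apply: sub_all Jpq => i /and3P[pi -> iq].
by rewrite (le_trans ap pi) (le_trans iq qb).
Qed.

(** Gronwall's lemma with zero initial value.  From a zero of [g], the mean value
    inequality over a length [h] with [L * h <= 1 / 2] halves any bound on [g],
    so [g] vanishes up to distance [h]; chaining such intervals reaches [b]. *)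
Lemma abs_continuous_gronwall0 (R : realType) (k : nat) (g : R -> 'rV[R]_k)
    (a b L : R) :
    a <= b -> 0 <= L -> abs_continuous a b g ->
    {ae @lebesgue_measure R, forall s, s \in `[a, b] ->
      exists2 v, is_derive (s : R^o) 1 (g : R^o -> 'rV[R]_k) v
               & `|v| <= L * `|g s|} ->
  g a = 0 -> g b = 0.
Proof.
move=> ab L0 gac gae.
(* Within distance [d] of a zero, absolute continuity bounds [g] by 1: this
   starts the halving. *)
have [d d0 Hd] := gac 1 ltr01.
pose h := Order.min (d / 2) (2 * (L + 1))^-1.
have L1 : 0 < 2 * (L + 1) by lra.
have h0 : 0 < h by rewrite lt_min divr_gt0//= invr_gt0.
have hd : h < d by rewrite gt_min; apply/orP; left; lra.
have Lh : L * h <= 2^-1.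
  have : h * (2 * (L + 1)) <= 1.
    by rewrite -ler_pdivlMr// mul1r ge_min lexx orbT.
  nra.
have step p q n : a <= p -> q <= b -> q - p <= h -> g p = 0 ->
    forall s, p <= s <= q -> `|g s| <= 2^-1 ^+ n.
  move=> ap qb qph gp0; elim: n => [|n IH] s /andP[ps sq].
    have := Hd [:: (p, s)]; rewrite /= !big_seq1/= gp0 subr0 => gs.
    by apply: ltW; apply: gs; rewrite ?ap ?ps ?(le_trans sq qb)//; lra.
  rewrite -[g s]subr0 -gp0.
  have c0 : 0 <= L * 2^-1 ^+ n by rewrite mulr_ge0// exprn_ge0.
  have sb : s <= b by exact: le_trans sq qb.
  have := abs_continuous_increment_le ps c0 (abs_continuous_sub ap sb gac).
  move=> /(_ _)/le_trans; apply.
    have := ae_filter_ringOfSetsType (@lebesgue_measure R) => ?.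
    apply: filterS gae => r gr; rewrite in_itv/= => /andP[pr rs].
    have [|v gv vL] := gr; first by rewrite in_itv/= (le_trans ap pr) (le_trans rs sb).
    exists v => //; apply: le_trans vL _; rewrite ler_wpM2l// IH// pr.
    exact: le_trans rs sq.
  rewrite exprS mulrAC ler_wpM2r ?exprn_ge0//.
  by apply: le_trans Lh; rewrite ler_wpM2l//; lra.
pose P y z := a <= y -> z <= b -> g y = 0 -> g z = 0.
suff : P a b by apply.
apply: interval_induction => // [x y z xy yz Pxy Pyz ax zb gx|x /andP[ax xb]].
  by apply: Pyz => //; [exact: le_trans xy | apply: Pxy => //; exact: le_trans zb].
exists (h / 2); first by rewrite divr_gt0.
move=> y z ay yx xz zb xy zx _ _ gy.
have gz n : `|g z| <= 2^-1 ^+ n.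
  by apply: (step y z) => //; [lra | rewrite lexx (le_trans yx xz)].
apply/eqP; rewrite -normr_eq0 eq_le normr_ge0 andbT; apply/ler_addgt0Pr => e e0.
have [n _ Hn] := near_infty_natSinv_expn_lt (PosNum e0).
rewrite add0r (le_trans (gz n))// exprVn ltW//.
by have := Hn n (leqnn n); rewrite /= div1r.
Qed.

(** The two controls have unrelated types: this is applied to the common part
    of the state, which each subsystem carries along under its own control. *)
Lemma lipschitz_trajectory_unique (R : realType) (k m m' : nat)
    (F : 'rV[R]_k -> 'rV[R]_k) (L t : R) (x : 'rV[R]_k)
    (u : R -> 'rV[R]_m) (u' : R -> 'rV[R]_m') (xi xi' : R -> 'rV[R]_k) :
    0 <= L -> (forall y y', `|F y - F y'| <= L * `|y - y'|) ->
    is_trajectory (fun y _ => F y) t x u xi ->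
    is_trajectory (fun y _ => F y) t x u' xi' ->
  {in `[t, 0], xi =1 xi'}.
Proof.
move=> L0 Flip [xit xiac xiae] [xi't xi'ac xi'ae] s.
rewrite in_itv/= => /andP[ts s0].
apply/eqP; rewrite -subr_eq0; apply/eqP.
have dac : abs_continuous t 0 (fun r => xi r - xi' r).
  apply: abs_continuous_le2 xiac xi'ac => p q.
  by rewrite opprD addrACA -opprD ler_normB.
apply: (abs_continuous_gronwall0 ts L0 (abs_continuous_sub _ s0 dac)) => //.
  have := ae_filter_ringOfSetsType (@lebesgue_measure R) => ?.
  apply: filterS2 xiae xi'ae => r Hr H'r; rewrite in_itv/= => /andP[tr rs].
  have rt0 : r \in `[t, 0] by rewrite in_itv/= tr (le_trans rs s0).
  exists (F (xi r) - F (xi' r)); last exact: Flip.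
  by have ? := Hr rt0; have ? := H'r rt0; apply: is_deriveB.
by rewrite xit xi't subrr.
Qed.

(** * Trajectories and selection of coordinates *)

Lemma row_norm_le (R : realType) (k : nat) (v : 'rV[R]_k) (e : R) :
  0 <= e -> (forall j, `|v 0 j| <= e) -> `|v| <= e.
Proof.
move=> e0 H; rewrite /Num.Def.normr/= mx_normrE; apply: bigmax_le => // -[i j] _.
by rewrite ord1 /=.
Qed.

Lemma coord_norm_le (R : realType) (k : nat) (v : 'rV[R]_k) j : `|v 0 j| <= `|v|.
Proof.
by rewrite [leRHS]/Num.Def.normr/= mx_normrE; exact: (le_bigmax _ _ (0, j)).
Qed.

Lemma is_derive_rowP (R : realType) (k : nat) (g : R -> 'rV[R]_k) (s : R)
    (v : 'rV[R]_k) :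
  is_derive (s : R^o) 1 (g : R^o -> 'rV[R]_k) v <->
  forall j, is_derive (s : R^o) 1 ((fun r => g r 0 j) : R^o -> R^o) (v 0 j).
Proof.
split=> [[/[dup] dg /derivable_mxP dgj gv] j|H].
  by apply: DeriveDef; [exact: dgj | rewrite -gv derive_mx// mxE].
have dg : derivable (g : R^o -> 'rV[R]_k) s 1.
  by apply/derivable_mxP => i j; rewrite ord1; have [] := H j.
apply: DeriveDef => //; rewrite derive_mx//; apply/rowP => j; rewrite mxE.
by have [] := H j.
Qed.

(** Both the projections and gluing select coordinates of their argument.
    Such maps are linear and do not increase the sup norm, and their
    composites and juxtapositions are again of this kind. *)
Definition coordinate_map (R : realType) (k l : nat)
    (P : 'rV[R]_k -> 'rV[R]_l) : Prop :=
  exists c : 'I_l -> 'I_k, forall z j, P z 0 j = z 0 (c j).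

Lemma coordinate_map_lsubmx (R : realType) (k l : nat) :
  coordinate_map (lsubmx : 'rV[R]_(k + l) -> 'rV[R]_k).
Proof. by exists (lshift l) => z j; rewrite mxE. Qed.

Lemma coordinate_map_rsubmx (R : realType) (k l : nat) :
  coordinate_map (rsubmx : 'rV[R]_(k + l) -> 'rV[R]_l).
Proof. by exists (@rshift k l) => z j; rewrite mxE. Qed.

Lemma coordinate_map_comp (R : realType) (k l p : nat)
    (Q : 'rV[R]_l -> 'rV[R]_p) (P : 'rV[R]_k -> 'rV[R]_l) :
  coordinate_map Q -> coordinate_map P -> coordinate_map (Q \o P).
Proof.
by move=> [d Qd] [c Pc]; exists (c \o d) => z j; rewrite /= Qd Pc.
Qed.

Lemma coordinate_map_row_mx (R : realType) (k l p : nat)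
    (P : 'rV[R]_k -> 'rV[R]_l) (Q : 'rV[R]_k -> 'rV[R]_p) :
  coordinate_map P -> coordinate_map Q ->
  coordinate_map (fun z => row_mx (P z) (Q z)).
Proof.
move=> [c Pc] [d Qd].
exists (fun j => match fintype.split j with inl i => c i | inr i => d i end) => z j.
by rewrite mxE; case: (fintype.split j) => i.
Qed.

Lemma coordinate_map_dist (R : realType) (k l : nat)
    (P : 'rV[R]_k -> 'rV[R]_l) y x :
  coordinate_map P -> `|P y - P x| <= `|y - x|.
Proof.
move=> [c Pc]; apply: row_norm_le => // j; rewrite !mxE !Pc.
by have := coord_norm_le (y - x) (c j); rewrite !mxE.
Qed.

(** The image dynamics [G] only has to match [F] along the given trajectory:
    this lets the identity of the common parts, which holds on [[t, 0]] only, and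
    the constraint on the control values enter as hypotheses on single times. *)
Lemma is_trajectory_coordinate_map (R : realType) (k l m p : nat)
    (F : 'rV[R]_k -> 'rV[R]_m -> 'rV[R]_k)
    (G : 'rV[R]_l -> 'rV[R]_p -> 'rV[R]_l) (P : 'rV[R]_k -> 'rV[R]_l)
    (t : R) (x : 'rV[R]_k) (u : R -> 'rV[R]_m) (v : R -> 'rV[R]_p)
    (xi : R -> 'rV[R]_k) :
    coordinate_map P ->
    {in `[t, 0], forall s, P (F (xi s) (u s)) = G (P (xi s)) (v s)} ->
  is_trajectory F t x u xi -> is_trajectory G t (P x) v (P \o xi).
Proof.
move=> cP PFG [xit xiac xiae]; split; first by rewrite /= xit.
  apply: (abs_continuous_le2 _ xiac xiac) => q r /=.
  by rewrite (le_trans (coordinate_map_dist _ _ cP))// lerDl.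
have := ae_filter_ringOfSetsType (@lebesgue_measure R) => ?.
apply: filterS xiae => s Hs /[dup] st0 /Hs/is_derive_rowP{}Hs.
rewrite /= -PFG//; apply/is_derive_rowP => j.
case: cP => c Pc; rewrite Pc.
by rewrite (_ : (fun _ => _) = fun r => xi r 0 (c j))//; apply/funext => r /=.
Qed.

Lemma is_trajectory_row_mx (R : realType) (k1 k2 m1 m2 : nat)
    (F1 : 'rV[R]_k1 -> 'rV[R]_m1 -> 'rV[R]_k1)
    (F2 : 'rV[R]_k2 -> 'rV[R]_m2 -> 'rV[R]_k2)
    (t : R) x1 x2 u1 u2 xi1 xi2 :
  is_trajectory F1 t x1 u1 xi1 -> is_trajectory F2 t x2 u2 xi2 ->
  is_trajectory
    (fun (x : 'rV[R]_(k1 + k2)) (u : 'rV[R]_(m1 + m2)) =>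
       row_mx (F1 (lsubmx x) (lsubmx u)) (F2 (rsubmx x) (rsubmx u)))
    t (row_mx x1 x2) (fun s => row_mx (u1 s) (u2 s))
    (fun s => row_mx (xi1 s) (xi2 s)).
Proof.
move=> [xi1t ac1 ae1] [xi2t ac2 ae2]; split; first by rewrite xi1t xi2t.
  apply: abs_continuous_le2 ac1 ac2 => q r.
  apply: row_norm_le; first by rewrite addr_ge0.
  move=> j; rewrite opp_row_mx add_row_mx mxE; case: (fintype.split j) => i.
    by rewrite (le_trans (coord_norm_le _ _))// lerDl.
  by rewrite (le_trans (coord_norm_le _ _))// lerDr.
have := ae_filter_ringOfSetsType (@lebesgue_measure R) => ?.
apply: filterS2 ae1 ae2 => s H1 H2 st0.
have /is_derive_rowP d1 := H1 st0; have /is_derive_rowP d2 := H2 st0.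
apply/is_derive_rowP => j; rewrite !row_mxKl !row_mxKr mxE.
rewrite (_ : (fun _ => _) = fun r => match fintype.split j with
  | inl i => xi1 r 0 i | inr i => xi2 r 0 i end); last first.
  by apply/funext => r; rewrite mxE.
by case: (fintype.split j).
Qed.

(** * Measurability of recombined controls *)

(** The Borel sigma-algebra of row vectors is the product one: an open set is the
    union of the boxes with rational centre and rational radius that it
    contains, and there are countably many of these. *)
Lemma measurable_fun_rowP (R : realType) d (T : measurableType d) (k : nat)
    (D : set T) (g : T -> 'rV[R]_k) :
  measurable_fun D (g : T -> g_sigma_algebraType (@open 'rV[R]_k)) <->
  forall j, measurable_fun D ((fun s => g s 0 j) : T -> g_sigma_algebraType (@open R)).
Proof.
have [mD|nD] := pselect (measurable D); last by split=> [_ j|_] /nD.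
split=> [mg j|gj].
  apply: (@measurability _ _ T (g_sigma_algebraType (@open R)) D _ open) => //.
  move=> _ [V oV <-]; apply: (mg mD ((fun y => y 0 j) @^-1` V)).
  apply: sub_gen_smallest; apply: open_comp oV => y _; exact: coord_continuous.
apply: (@measurability _ _ T (g_sigma_algebraType (@open 'rV[R]_k)) D g open) => // _ [V oV <-].
pose box (p : 'rV[rat]_k * rat) j := ball (ratr (p.1 0 j) : R) (ratr p.2).
pose boxes_in_V := [set p | [set y : 'rV[R]_k | forall j, box p j (y 0 j)] `<=` V].
rewrite (_ : D `&` _ = \bigcup_(p in boxes_in_V)
    (D `&` \bigcap_j (D `&` [set s | box p j (g s 0 j)]))); last first.
  apply/seteqP; split => s /=; last first.
    by move=> [p /= pV [Ds gs]]; split=> //; apply: pV => j; have [] := gs j I.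
  move=> [Ds Vs].
  have /nbhs_ballP[e /= e0 eV] := open_nbhs_nbhs (conj oV Vs).
  have e20 : 0 < e / 2 by rewrite divr_gt0.
  have [r] := rat_in_itvoo e20; rewrite in_itv/= => /andP[r0 re].
  have qP j : exists q, ratr q \in `]g s 0 j - ratr r, g s 0 j + ratr r[.
    by apply: rat_in_itvoo; rewrite ltrD2l gt0_cp.
  (* A box of radius below [e / 2] that contains [g s] lies in the ball of
     radius [e] around [g s]. *)
  exists (\row_j sval (cid (qP j)), r) => /=.
    move=> y /= ybox; apply: eV; split=> // i j; rewrite ord1 /ball/=.
    have := ybox j; rewrite /box /ball/= mxE.
    case: cid => q /=; rewrite in_itv/= => /andP[q1 q2].
    rewrite ltr_norml => /andP[y1 y2].
    by rewrite ltr_norml; apply/andP; split; lra.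
  split=> // j _; split=> //=; rewrite /box /ball/= mxE.
  case: cid => q /=; rewrite in_itv/= => /andP[q1 q2].
  by rewrite ltr_norml; apply/andP; split; lra.
rewrite bigcup_mkcond; apply: countable_bigcupT_measurable => // p.
case: ifPn => // _.
apply: measurableI => //; apply: fin_bigcap_measurable; first exact: finite_finset.
by move=> j _; apply: (gj j mD); apply: sub_gen_smallest; apply: ball_open.
Qed.

(** Here the absence of shared control components matters: over a set [U] that is
    not a product, the recombined control could leave [U]. *)
Lemma controls_row_mx (R : realType) (m1 m2 : nat)
    (U1 : set 'rV[R]_m1) (U2 : set 'rV[R]_m2) (t : R)
    (u v : R -> 'rV[R]_(m1 + m2)) :
  controls (control_product U1 U2) t u -> controls (control_product U1 U2) t v ->
  controls (control_product U1 U2) t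
    (fun s => row_mx (lsubmx (u s)) (rsubmx (v s))).
Proof.
move=> [/measurable_fun_rowP mu Uu] [/measurable_fun_rowP mv Uv]; split.
  apply/measurable_fun_rowP => j; rewrite -(splitK j).
  case: (fintype.split j) => i /=.
    rewrite (_ : (fun _ => _) = fun s => u s 0 (lshift m2 i)); first exact: mu.
    by apply/funext => s; rewrite row_mxEl mxE.
  rewrite (_ : (fun _ => _) = fun s => v s 0 (rshift m1 i)); first exact: mv.
  by apply/funext => s; rewrite row_mxEr mxE.
move=> s st; rewrite /control_product/= row_mxKl row_mxKr.
by split; [have [] := Uu s st | have [] := Uv s st].
Qed.

(** * Splitting and gluing the trajectories of a decomposed system *)

Lemma coordinate_map_proj1 (R : realType) (n1 n2 nc : nat) :
  coordinate_map (@proj1 R n1 n2 nc).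
Proof.
apply: coordinate_map_row_mx; last exact: coordinate_map_rsubmx.
apply: (coordinate_map_comp (Q := lsubmx)) => //; exact: coordinate_map_lsubmx.
Qed.

Lemma coordinate_map_proj2 (R : realType) (n1 n2 nc : nat) :
  coordinate_map (@proj2 R n1 n2 nc).
Proof.
apply: coordinate_map_row_mx; last exact: coordinate_map_rsubmx.
apply: (coordinate_map_comp (Q := rsubmx)).
  exact: coordinate_map_rsubmx.
exact: coordinate_map_lsubmx.
Qed.

(** The common part is taken from the first subsystem; [glue] is used on pairs of
    states whose common parts agree. *)
Definition glue (R : realType) (n1 n2 nc : nat)
    (x1 : 'rV[R]_(n1 + nc)) (x2 : 'rV[R]_(n2 + nc)) : 'rV[R]_(n1 + n2 + nc) :=
  row_mx (row_mx (lsubmx x1) (lsubmx x2)) (rsubmx x1).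

Lemma proj1_glue (R : realType) (n1 n2 nc : nat)
    (x1 : 'rV[R]_(n1 + nc)) (x2 : 'rV[R]_(n2 + nc)) :
  proj1 (glue x1 x2) = x1.
Proof. by rewrite /proj1 /st1 /stc /glue !row_mxKl row_mxKr hsubmxK. Qed.

Lemma proj2_glue (R : realType) (n1 n2 nc : nat)
    (x1 : 'rV[R]_(n1 + nc)) (x2 : 'rV[R]_(n2 + nc)) :
  rsubmx x1 = rsubmx x2 -> proj2 (glue x1 x2) = x2.
Proof.
by move=> x12; rewrite /proj2 /st2 /stc /glue row_mxKl !row_mxKr x12 hsubmxK.
Qed.

Lemma glue_proj (R : realType) (n1 n2 nc : nat) (z : 'rV[R]_(n1 + n2 + nc)) :
  glue (proj1 z) (proj2 z) = z.
Proof.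
by rewrite /glue /proj1 /proj2 /st1 /st2 /stc !row_mxKl row_mxKr !hsubmxK.
Qed.

Lemma coordinate_map_glue (R : realType) (n1 n2 nc : nat) :
  coordinate_map (fun x : 'rV[R]_((n1 + nc) + (n2 + nc)) =>
    glue (lsubmx x) (rsubmx x)).
Proof.
have cl := @coordinate_map_lsubmx R; have cr := @coordinate_map_rsubmx R.
apply: coordinate_map_row_mx; first apply: coordinate_map_row_mx.
- exact: (coordinate_map_comp (cl _ _) (cl _ _)).
- exact: (coordinate_map_comp (cl _ _) (cr _ _)).
- exact: (coordinate_map_comp (cr _ _) (cl _ _)).
Qed.

Section decomposed_system.
Context {R : realType} {n1 n2 nc m1 m2 : nat}.
Context {f : 'rV[R]_(n1 + n2 + nc) -> 'rV[R]_(m1 + m2) -> 'rV[R]_(n1 + n2 + nc)}.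
Context {U : set 'rV[R]_(m1 + m2)}.
Context {f1 : 'rV[R]_n1 -> 'rV[R]_nc -> 'rV[R]_m1 -> 'rV[R]_n1}.
Context {f2 : 'rV[R]_n2 -> 'rV[R]_nc -> 'rV[R]_m2 -> 'rV[R]_n2}.
Context {fc : 'rV[R]_nc -> 'rV[R]_nc}.
Hypothesis hdec : decomposes f U f1 f2 fc.
Let F1 := sub_dynamics f1 fc.
Let F2 := sub_dynamics f2 fc.

Lemma is_trajectory_proj1 t z u zeta :
    {in `[t, 0], forall s, U (u s)} -> is_trajectory f t z u zeta ->
  is_trajectory F1 t (proj1 z) (lsubmx \o u) (@proj1 R n1 n2 nc \o zeta).
Proof.
move=> Uu; apply: is_trajectory_coordinate_map => [|s st].
  exact: coordinate_map_proj1.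
rewrite hdec; last exact: Uu.
by rewrite /proj1 /F1 /sub_dynamics /st1 /stc !row_mxKl !row_mxKr.
Qed.

Lemma is_trajectory_proj2 t z u zeta :
    {in `[t, 0], forall s, U (u s)} -> is_trajectory f t z u zeta ->
  is_trajectory F2 t (proj2 z) (rsubmx \o u) (@proj2 R n1 n2 nc \o zeta).
Proof.
move=> Uu; apply: is_trajectory_coordinate_map => [|s st].
  exact: coordinate_map_proj2.
rewrite hdec; last exact: Uu.
by rewrite /proj2 /F2 /sub_dynamics /st2 /stc !row_mxKl !row_mxKr.
Qed.

(** The glued trajectory is a coordinate map of the trajectory of the product of
    the two subsystems.  At each time, the second subsystem sees its own common
    part, which has to be replaced by that of the first. *)
Lemma is_trajectory_glue t z u xi1 xi2 :
    {in `[t, 0], forall s, U (u s)} ->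
    {in `[t, 0], forall s, rsubmx (xi1 s) = rsubmx (xi2 s)} ->
    is_trajectory F1 t (proj1 z) (lsubmx \o u) xi1 ->
    is_trajectory F2 t (proj2 z) (rsubmx \o u) xi2 ->
  is_trajectory f t z u (fun s => glue (xi1 s) (xi2 s)).
Proof.
move=> Uu xi12 tr1 tr2; have := is_trajectory_row_mx tr1 tr2.
move=> /(is_trajectory_coordinate_map (G := f) (v := u)
  (@coordinate_map_glue R n1 n2 nc)); rewrite row_mxKl row_mxKr glue_proj => H.
have -> : (fun s => glue (xi1 s) (xi2 s)) =
    (fun x => glue (lsubmx x) (rsubmx x)) \o (fun s => row_mx (xi1 s) (xi2 s)).
  by apply/funext => s; rewrite /= row_mxKl row_mxKr.
apply: H => s st; rewrite hdec; last exact: Uu.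
rewrite /= !row_mxKl !row_mxKr /glue /F1 /F2 /sub_dynamics /st1 /st2 /stc.
by rewrite !row_mxKl !row_mxKr -xi12.
Qed.

(** [fc] is read off from [f] by varying only the common part of the state, at
    any fixed admissible control value. *)
Lemma common_dynamics_lipschitz u : regular_dynamics f U -> U u ->
  exists2 L : R, 0 <= L & forall y y', `|fc y - fc y'| <= L * `|y - y'|.
Proof.
move=> [_ _ /(_ u)/[swap] Uu /(_ Uu) flip].
have /filter_ex[L [L0 HL]] : \forall L \near +oo, 0 <= L /\
    L.-lipschitz_setT (f^~ u).
  by near=> L; split; near: L; [apply: nbhs_pinfty_ge; rewrite num_real|].
exists L => // y y'.
pose z (w : 'rV[R]_nc) : 'rV[R]_(n1 + n2 + nc) := row_mx 0 w.
have fz w : fc w = rsubmx (f (z w) u) by rewrite hdec// row_mxKr /stc row_mxKr.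
rewrite !fz (le_trans (coordinate_map_dist _ _ (@coordinate_map_rsubmx _ _ _)))//.
apply: le_trans (HL (z y, z y') _) _ => //=.
rewrite ler_wpM2l// /z opp_row_mx add_row_mx subrr.
apply: row_norm_le => // j; rewrite mxE; case: (fintype.split j) => i.
  by rewrite mxE normr0.
exact: coord_norm_le.
Unshelve. all: by end_near.
Qed.

(** Forgetting [z1] or [z2] leaves two solutions of the same equation for the
    common part, from the same point [stc z]. *)
Lemma common_part_unique (L t : R) z u1 u2 xi1 xi2 :
    0 <= L -> (forall y y', `|fc y - fc y'| <= L * `|y - y'|) ->
    is_trajectory F1 t (proj1 z) u1 xi1 -> is_trajectory F2 t (proj2 z) u2 xi2 ->
  {in `[t, 0], forall s, rsubmx (xi1 s) = rsubmx (xi2 s)}.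
Proof.
move=> L0 fclip tr1 tr2.
have c1 : is_trajectory (fun y _ => fc y) t (stc z) u1 (rsubmx \o xi1).
  rewrite -[stc z](row_mxKr (st1 z)).
  apply: is_trajectory_coordinate_map tr1; first exact: coordinate_map_rsubmx.
  by move=> s _; rewrite row_mxKr.
have c2 : is_trajectory (fun y _ => fc y) t (stc z) u2 (rsubmx \o xi2).
  rewrite -[stc z](row_mxKr (st2 z)).
  apply: is_trajectory_coordinate_map tr2; first exact: coordinate_map_rsubmx.
  by move=> s _; rewrite row_mxKr.
exact: lipschitz_trajectory_unique L0 fclip c1 c2.
Qed.

(** A competitor of one projected trajectory is glued to the other one; the
    result is a trajectory of the full system, hence equal to [zeta]. *)
Lemma is_unique_trajectory_proj t z u zeta :
    regular_dynamics f U -> t <= 0 -> {in `[t, 0], forall s, U (u s)} ->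
    is_unique_trajectory f t z u zeta ->
  is_unique_trajectory F1 t (proj1 z) (lsubmx \o u) (@proj1 R n1 n2 nc \o zeta) /\
  is_unique_trajectory F2 t (proj2 z) (rsubmx \o u) (@proj2 R n1 n2 nc \o zeta).
Proof.
move=> hf t0 Uu [tr uniq].
have [L L0 fclip] : exists2 L : R, 0 <= L &
    forall y y', `|fc y - fc y'| <= L * `|y - y'|.
  by apply: (common_dynamics_lipschitz hf (Uu t _)); rewrite in_itv/= lexx t0.
have tr1 := is_trajectory_proj1 Uu tr; have tr2 := is_trajectory_proj2 Uu tr.
split; split=> // xi tr' s st.
  have xic := common_part_unique L0 fclip tr' tr2.
  by rewrite /= -(uniq _ (is_trajectory_glue Uu xic tr' tr2) s st) proj1_glue.
have xic := common_part_unique L0 fclip tr1 tr'.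
rewrite /= -(uniq _ (is_trajectory_glue Uu xic tr1 tr') s st) proj2_glue//.
exact: xic.
Qed.

(** The equality at time 0 is what makes the second projection of the glued end
    point equal to [xi2 0], so that both target conditions carry over. *)
Lemma is_unique_trajectory_glue t z u xi1 xi2 :
    regular_dynamics f U -> t <= 0 -> {in `[t, 0], forall s, U (u s)} ->
    is_unique_trajectory F1 t (proj1 z) (lsubmx \o u) xi1 ->
    is_unique_trajectory F2 t (proj2 z) (rsubmx \o u) xi2 ->
  is_unique_trajectory f t z u (fun s => glue (xi1 s) (xi2 s)) /\
  rsubmx (xi1 0) = rsubmx (xi2 0).
Proof.
move=> hf t0 Uu [tr1 uniq1] [tr2 uniq2].
have [L L0 fclip] : exists2 L : R, 0 <= L &
    forall y y', `|fc y - fc y'| <= L * `|y - y'|.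
  by apply: (common_dynamics_lipschitz hf (Uu t _)); rewrite in_itv/= lexx t0.
have xic := common_part_unique L0 fclip tr1 tr2.
split; last by apply: xic; rewrite in_itv/= t0 lexx.
split; first exact: is_trajectory_glue.
move=> zeta tr s st; rewrite -[zeta s]glue_proj.
congr glue.
  exact: uniq1 (is_trajectory_proj1 Uu tr) s st.
exact: uniq2 (is_trajectory_proj2 Uu tr) s st.
Qed.

End decomposed_system.
Unset Implicit Arguments.

Theorem proposition1 (R : realType) (n1 n2 nc m1 m2 : nat)
    (hn1 : (0 < n1)%N) (hn2 : (0 < n2)%N)
    (U : set 'rV[R]_(m1 + m2)) (U1 : set 'rV[R]_m1) (U2 : set 'rV[R]_m2)
    (hUcompact : compact U) (hUprod : U = control_product U1 U2)
    (f : 'rV[R]_(n1 + n2 + nc) -> 'rV[R]_(m1 + m2) -> 'rV[R]_(n1 + n2 + nc))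
    (hf : regular_dynamics f U)
    (f1 : 'rV[R]_n1 -> 'rV[R]_nc -> 'rV[R]_m1 -> 'rV[R]_n1)
    (f2 : 'rV[R]_n2 -> 'rV[R]_nc -> 'rV[R]_m2 -> 'rV[R]_n2)
    (fc : 'rV[R]_nc -> 'rV[R]_nc)
    (hdec : decomposes f U f1 f2 fc)
    (t : R) (ht : t < 0)
    (T : set 'rV[R]_(n1 + n2 + nc))
    (T1 : set 'rV[R]_(n1 + nc)) (T2 : set 'rV[R]_(n2 + nc))
    (hT : T = (@proj1 R n1 n2 nc @^-1` T1) `&` (@proj2 R n1 n2 nc @^-1` T2)) :
  max_brs f U T t =
    (@proj1 R n1 n2 nc @^-1` sub_max_brs (sub_dynamics f1 fc) lsubmx U T1 t)
    `&`
    (@proj2 R n1 n2 nc @^-1` sub_max_brs (sub_dynamics f2 fc) rsubmx U T2 t).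
Proof.
have t0 := ltW ht.
apply/seteqP; split=> [z [u uU [zeta zuniq]]|z [] /=].
  rewrite hT => -[zT1 zT2].
  have [z1 z2] := is_unique_trajectory_proj hdec hf t0 uU.2 zuniq.
  by split; exists u => //; [exists (@proj1 R n1 n2 nc \o zeta)
                            |exists (@proj2 R n1 n2 nc \o zeta)].
move=> [u uU [xi1 uniq1 xT1]] [v vU [xi2 uniq2 xT2]].
pose w s := row_mx (lsubmx (u s)) (rsubmx (v s)).
have wU : controls U t w.
  by move: uU vU; rewrite hUprod; exact: controls_row_mx.
have wl : lsubmx \o u = lsubmx \o w by apply/funext => s; rewrite /= row_mxKl.
have wr : rsubmx \o v = rsubmx \o w by apply/funext => s; rewrite /= row_mxKr.
rewrite wl in uniq1; rewrite wr in uniq2.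
have [uniq xic] := is_unique_trajectory_glue hdec hf t0 wU.2 uniq1 uniq2.
exists w => //; exists (fun s => glue (xi1 s) (xi2 s)) => //.
by rewrite hT; split; rewrite /= ?proj1_glue ?proj2_glue.
Qed.
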